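(* For every $m\in\mathbb N$ there is a constant $C>0$ such that for every $n$ and every $m$-homogeneous polynomial $P(z)=\sum_{\mathbf j\in\mathcal J(m,n)}c_{\mathbf j}z_{j_1}\cdots z_{j_m}$ on $\mathbb C^n$, \[\big\|(c_{\mathbf j})_{\mathbf j\in\mathcal J(m,n)}\big\|_{\ell_{\frac{2m}{m+1},1}}\le C\|P\|_\infty;\] that is, $\mathrm{BH}^{\mathrm{pol}}_{\ell_{\frac{2m}{m+1},1}}(m)<\infty$.
   Context: $\mathcal J(m,n)=\{(j_1,\dots,j_m):1\le j_1\le\dots\le j_m\le n\}$; every $m$-homogeneous polynomial on $\mathbb C^n$ has a unique representation as displayed; $\|P\|_\infty=\sup_{z\in\mathbb C^n,\|z\|_\infty\le1}|P(z)|$. For a finite index set $I$ and $1<p<\infty$, $\|x\|_{\ell_{p,1}(I)}=\sum_k x_k^*(k^{1/p}-(k-1)^{1/p})$, where $x^*$ is the non-increasing rearrangement of $(|x_i|)_{i\in I}$. $\mathrm{BH}^{\mathrm{pol}}_X(m)$ is the best constant $C\ge 1$ in the displayed inequality with $\ell_{\frac{2m}{m+1},1}$ replaced by $X$. *)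

(* Defs.v *)
From HB Require Import structures.
From mathcomp Require Import all_boot all_order all_algebra.
From mathcomp Require Import all_classical all_reals all_analysis.
From mathcomp Require Import complex.
Set Implicit Arguments. Unset Strict Implicit. Unset Printing Implicit Defensive.
Import Order.TTheory GRing.Theory Num.Theory.
Local Open Scope ring_scope.

(* J(m,n) = { (j_1,...,j_m) : 1 <= j_1 <= ... <= j_m <= n }, with indices
   shifted to 0..n-1 (elements of 'I_n). *)
Definition Jidx (m n : nat) :=
  {t : m.-tuple 'I_n | sorted (fun i j : 'I_n => (i <= j)%N) t}.

Definition polyJ (R : rcfType) (m n : nat) (c : Jidx m n -> R[i])
  (z : 'I_n -> R[i]) : R[i] :=
  \sum_(j : Jidx m n) c j * \prod_(k < m) z (tnth (val j) k).

Definition cabs (R : rcfType) (z : R[i]) : R := ComplexField.Normc.normc z.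

Definition supnorm_poly (R : realType) (m n : nat) (c : Jidx m n -> R[i]) : R :=
  sup [set cabs (polyJ c z) | z in [set z : 'I_n -> R[i] | forall i, cabs (z i) <= 1]].

Definition lorentz_norm (R : realType) (p : R) (I : finType) (x : I -> R) : R :=
  let s := sort (fun a b : R => b <= a) [seq `|x i| | i <- enum I] in
  \sum_(k < size s) s`_k * ((k.+1)%:R `^ p^-1 - (k%:R) `^ p^-1).

(* Main.v *)
(* Evaluating the real and imaginary parts of [P] at real points reduces everything to
   real coefficients and real signs. Polarization turns [P] into an [m]-linear form on
   [R^n] whose coefficients [b] dominate those of [P], and the L1-L2 Khintchine
   inequality for Walsh polynomials of degree [m] bounds, for each direction [k], the
   mixed norm [sum_i (sum_(x k = i) b_x^2)^(1/2)] by [||P||].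
   Such mixed norms control the Lorentz norm by duality: the Lorentz norm is at most
   [sum_t a*_t t^(1/p - 1)], and with [(t^(1/p - 1))^2 = t^(1/m - 1)] it suffices, by
   Cauchy-Schwarz along fibres, to assign a direction to every point of a ranked subset
   of the grid [n]^m so that the weights [t^(1/m - 1)] of the points assigned to
   a common fibre have bounded sum. *)
Require Import Defs.
From HB Require Import structures.
From mathcomp Require Import all_boot all_order all_algebra all_fingroup.
From mathcomp Require Import all_classical all_reals all_analysis.
From mathcomp Require Import complex ring lra zify.
From mathcomp Require Import seq fintype finset.
Set Implicit Arguments. Unset Strict Implicit. Unset Printing Implicit Defensive.
Import Order.TTheory GRing.Theory Num.Theory.
Local Open Scope ring_scope.

(** * Khintchine's inequality for Walsh polynomials *)

Lemma cauchy_schwarz (R : realFieldType) (I : Type) (r : seq I) (P : pred I) (a b : I -> R) :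
  (\sum_(i <- r | P i) a i * b i) ^+ 2
    <= (\sum_(i <- r | P i) a i ^+ 2) * (\sum_(i <- r | P i) b i ^+ 2).
Proof.
(* Lagrange's identity: this double sum of squares is twice the gap between the two sides. *)
have h : 0 <= \sum_(i <- r | P i) \sum_(j <- r | P j) (a i * b j - a j * b i) ^+ 2.
  by apply: sumr_ge0 => i _; apply: sumr_ge0 => j _; apply: sqr_ge0.
rewrite expr2; set S := \sum_(i <- r | P i) a i * b i in h *.
set A := \sum_(i <- r | P i) a i ^+ 2; set B := \sum_(i <- r | P i) b i ^+ 2.
suff e : \sum_(i <- r | P i) \sum_(j <- r | P j) (a i * b j - a j * b i) ^+ 2
      = (A * B - S * S) *+ 2.
  by move: h; rewrite e pmulrn_lge0 // subr_ge0.
transitivity (\sum_(i <- r | P i) (a i ^+ 2 * B + b i ^+ 2 * A - a i * b i * S *+ 2)).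
  apply: eq_bigr => i _; rewrite !mulr_sumr -sumrMnl -big_split /= -sumrB.
  by apply: eq_bigr => j _; ring.
by rewrite sumrB big_split sumrMnl -!mulr_suml /= -/A -/B -/S; ring.
Qed.

Section Signs.
Variables (R : realFieldType) (V : finType).
Implicit Types (f g : {ffun V -> bool} -> R) (A S : {set V}) (e : {ffun V -> bool}).

Definition walsh A e : R := \prod_(v in A) (-1) ^+ e v.
Definition mean f : R := (\sum_e f e) / #|{ffun V -> bool}|%:R.
Definition flip (v : V) e : {ffun V -> bool} := [ffun u => e u (+) (u == v)].

Lemma eq_mean f g : f =1 g -> mean f = mean g.
Proof. by move=> fg; rewrite /mean (eq_bigr _ (fun e _ => fg e)). Qed.

Lemma meanD f g : mean (fun e => f e + g e) = mean f + mean g.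
Proof. by rewrite /mean big_split mulrDl. Qed.

Lemma meanZ (a : R) f : mean (fun e => a * f e) = a * mean f.
Proof. by rewrite /mean -mulr_sumr mulrA. Qed.

Lemma mean_cst (a : R) : mean (fun=> a) = a.
Proof.
rewrite /mean sumr_const -[a *+ _]mulr_natr mulfK //.
by rewrite pnatr_eq0 card_ffun card_bool expn_eq0.
Qed.

Lemma mean_sum (I : finType) (F : I -> {ffun V -> bool} -> R) :
  mean (fun e => \sum_i F i e) = \sum_i mean (F i).
Proof. by rewrite /mean exchange_big mulr_suml. Qed.

Lemma ler_mean f g : (forall e, f e <= g e) -> mean f <= mean g.
Proof. by move=> fg; rewrite ler_wpM2r ?invr_ge0 ?ler0n // ler_sum. Qed.

Lemma mean_ge0 f : (forall e, 0 <= f e) -> 0 <= mean f.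
Proof. by move=> f0; rewrite -(mean_cst 0); apply: ler_mean. Qed.

Lemma flipK v : involutive (flip v).
Proof. by move=> e; apply/ffunP => u; rewrite !ffunE -addbA addbb addbF. Qed.

Lemma mean_odd v f : (forall e, f (flip v e) = - f e) -> mean f = 0.
Proof.
move=> fo; have e : mean f = - mean f.
  rewrite {1}/mean (reindex_inj (inv_inj (flipK v))) /=.
  by rewrite (eq_bigr _ (fun e _ => fo e)) sumrN mulNr.
by apply/eqP; rewrite -[_ == 0](mulrn_eq0 _ 2) mulr2n {1}e addNr.
Qed.

Lemma mean_cauchy_schwarz f g :
  mean (fun e => f e * g e) ^+ 2 <= mean (fun e => f e ^+ 2) * mean (fun e => g e ^+ 2).
Proof.
rewrite /mean expr_div_n mulrACA -invfM -expr2 ler_wpM2r ?invr_ge0 ?sqr_ge0 //.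
exact: cauchy_schwarz.
Qed.

Lemma walsh_flip A v e : v \notin A -> walsh A (flip v e) = walsh A e.
Proof.
move=> vA; apply: eq_bigr => u uA; rewrite ffunE.
by have -> : (u == v) = false; [apply: contraNF vA => /eqP <- | rewrite addbF].
Qed.

Lemma walshD1 A v e : v \in A -> walsh A e = (-1) ^+ e v * walsh (A :\ v) e.
Proof.
move=> vA; rewrite /walsh (bigD1 v) //=; congr (_ * _).
by apply: eq_bigl => u; rewrite !inE andbC.
Qed.

Lemma walsh0 e : walsh set0 e = 1.
Proof. by rewrite /walsh big_set0. Qed.

(* Splitting off one variable [v] writes the sum as [G + e_v H] with [G], [H]
   independent of [e_v] and [H] of degree [d - 1], so the odd moments cancel. *)
Lemma bonami (X : finType) (b : X -> R) S (P : pred X) (A : X -> {set V}) d :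
    (forall x, P x -> A x \subset S) -> {in P &, injective A} ->
    (forall x, P x -> (#|A x| <= d)%N) ->
  let F e := \sum_(x | P x) b x * walsh (A x) e in
  mean (fun e => F e ^+ 2) = \sum_(x | P x) b x ^+ 2 /\
  mean (fun e => F e ^+ 4) <= 9 ^+ d * (\sum_(x | P x) b x ^+ 2) ^+ 2.
Proof.
move: {2}#|S| (erefl #|S|) => n; elim: n S P A d => [|n IHn] S P A d cS AS Ainj Ad F.
  (* With no variable left every [A x] is empty, so injectivity allows at most one index in [P]. *)
  have S0 : S = set0 by apply/eqP; rewrite -cards_eq0 cS.
  have A0 x : P x -> A x = set0 by move=> /AS; rewrite S0 subset0 => /eqP.
  have FE e : F e = \sum_(x | P x) b x.
    by apply: eq_bigr => x Px; rewrite A0 // walsh0 mulr1.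
  have sq : (\sum_(x | P x) b x) ^+ 2 = \sum_(x | P x) b x ^+ 2.
    case: (pickP P) => [x0 Px0|P0]; last by rewrite !big_pred0 // expr0n.
    have PE : P =1 pred1 x0.
      move=> x; apply/idP/eqP => [Px|->//].
      by apply: Ainj; rewrite // !A0.
    by rewrite !(eq_bigl _ _ PE) !big_pred1_eq.
  split; first by rewrite (eq_mean (g := fun=> (\sum_(x | P x) b x) ^+ 2)) ?mean_cst// => e; rewrite FE.
  rewrite (eq_mean (g := fun=> (\sum_(x | P x) b x) ^+ 4)); last by move=> e; rewrite FE.
  rewrite mean_cst -sq -exprM ler_peMl ?exprn_even_ge0 //.
  by apply: exprn_ege1; rewrite ler1n.
have [v vS] : exists v, v \in S by apply/set0Pn; rewrite -cards_eq0 cS.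
pose P1 x := P x && (v \notin A x); pose P2 x := P x && (v \in A x).
pose A2 x := A x :\ v.
have cS' : #|S :\ v| = n by move: cS; rewrite (cardsD1 v) vS => -[].
have [||| g2 g4] := IHn (S :\ v) P1 A d cS'.
- by move=> x /andP[Px vx]; rewrite subsetD1 AS.
- by move=> x y /andP[Px _] /andP[Py _]; apply: Ainj.
- by move=> x /andP[Px _]; apply: Ad.
have [||| h2 h4] := IHn (S :\ v) P2 A2 d.-1 cS'.
- by move=> x /andP[Px vx]; rewrite setSD // AS.
- move=> x y /andP[Px vx] /andP[Py vy] e; apply: Ainj => //.
  by rewrite -(setD1K vx) -(setD1K vy); congr (_ |: _).
- by move=> x /andP[Px vx]; move: (Ad _ Px); rewrite (cardsD1 v) vx; case: (d).
pose G e := \sum_(x | P1 x) b x * walsh (A x) e.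
pose H e := \sum_(x | P2 x) b x * walsh (A2 x) e.
pose g := \sum_(x | P1 x) b x ^+ 2; pose h := \sum_(x | P2 x) b x ^+ 2.
change (mean (fun e => G e ^+ 2) = g) in g2.
change (mean (fun e => H e ^+ 2) = h) in h2.
change (is_true (mean (fun e => G e ^+ 4) <= 9 ^+ d * g ^+ 2)) in g4.
change (is_true (mean (fun e => H e ^+ 4) <= 9 ^+ d.-1 * h ^+ 2)) in h4.
have bE : \sum_(x | P x) b x ^+ 2 = g + h.
  by rewrite (bigID (fun x => v \in A x)) addrC.
have FE e : F e = G e + (-1) ^+ e v * H e.
  rewrite /F (bigID (fun x => v \in A x)) addrC /=; congr (_ + _).
  rewrite mulr_sumr; apply: eq_bigr => x /andP[_ vx].
  by rewrite (walshD1 _ vx) mulrCA.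
have Gf e : G (flip v e) = G e.
  by apply: eq_bigr => x /andP[_ vx]; rewrite walsh_flip.
have Hf e : H (flip v e) = H e.
  by apply: eq_bigr => x /andP[_ vx]; rewrite walsh_flip // !inE eqxx.
have sf e : (-1) ^+ flip v e v = - (-1) ^+ e v :> R.
  by rewrite ffunE eqxx addbT signrN.
have s2 e : (-1) ^+ e v * (-1) ^+ e v = 1 :> R by rewrite -expr2 sqrr_sign.
split.
  rewrite (eq_mean (g := fun e => (G e ^+ 2 + H e ^+ 2) + 2 * ((-1) ^+ e v * G e * H e))); last first.
    by move=> e; rewrite FE; ring: (s2 e).
  rewrite !meanD meanZ [X in 2 * X](mean_odd (v := v)); last by move=> e; rewrite Gf Hf sf; ring.
  by rewrite mulr0 addr0 g2 h2 bE.
rewrite (eq_mean (g := fun e => (G e ^+ 4 + H e ^+ 4 + 6 * (G e ^+ 2 * H e ^+ 2))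
   + 4 * ((-1) ^+ e v * (G e ^+ 3 * H e + G e * H e ^+ 3)))); last first.
  move=> e; rewrite FE; move: (s2 e); set s := (-1) ^+ e v => ss.
  have s3 : s * s * s = s by rewrite ss mul1r.
  have s4 : s * s * s * s = 1 by rewrite s3.
  by ring: ss s3 s4.
rewrite meanD [mean (fun e => 4 * _)]meanZ [X in 4 * X](mean_odd (v := v)); last first.
  by move=> e; rewrite Gf Hf sf; ring.
rewrite mulr0 addr0 !meanD meanZ.
have g0 : 0 <= g by apply: sumr_ge0 => x _; apply: sqr_ge0.
have h0 : 0 <= h by apply: sumr_ge0 => x _; apply: sqr_ge0.
have := mean_cauchy_schwarz (fun e => G e ^+ 2) (fun e => H e ^+ 2).
rewrite [X in _ <= X * _](eq_mean (g := fun e => G e ^+ 4)); last by move=> e; rewrite -exprM.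
rewrite [X in _ <= _ * X](eq_mean (g := fun e => H e ^+ 4)); last by move=> e; rewrite -exprM.
have G40 : 0 <= mean (fun e => G e ^+ 4) by apply: mean_ge0 => e; apply: exprn_even_ge0.
have H40 : 0 <= mean (fun e => H e ^+ 4) by apply: mean_ge0 => e; apply: exprn_even_ge0.
move: G40 H40 g4 h4; rewrite bE.
move: (mean (fun e => G e ^+ 4)) (mean (fun e => H e ^+ 4)) (mean (fun e => G e ^+ 2 * H e ^+ 2)) => a c q a0 c0 ag ch qs.
have K0 : 0 <= 9 ^+ d.-1 * (g * h) by rewrite !mulr_ge0 // ?exprn_ge0.
(* For [d = 0] the power identity fails, but then no [A x] contains [v] and [h] vanishes. *)
have dh : 9 ^+ d * h = 9 * 9 ^+ d.-1 * h.
  case: (posnP d) => [d0|dp]; last by rewrite -exprS prednK.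
  suff -> : h = 0 by rewrite !mulr0.
  apply: big1 => x /andP[Px vx]; move: (Ad _ Px).
  by rewrite d0 leqn0 cards_eq0 => /eqP A0; rewrite A0 inE in vx.
(* Cauchy-Schwarz on the two fourth moments. With the binomial factor 6 this gives at most
   [2 * 9 ^+ d * g * h], the cross term of [9 ^+ d * (g + h) ^+ 2]. *)
have hq : q <= 3 * (9 ^+ d.-1 * (g * h)).
  rewrite leNgt; apply/negP => lt.
  have : (3 * (9 ^+ d.-1 * (g * h))) ^+ 2 < q ^+ 2.
    have L0 : 0 <= 3 * (9 ^+ d.-1 * (g * h)) by apply: mulr_ge0.
    by rewrite ltr_pXn2r ?nnegrE // (le_trans L0 (ltW lt)).
  apply/negP; rewrite -leNgt; apply: (le_trans qs).
  apply: (le_trans (ler_pM a0 c0 ag ch)).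
  have -> : 9 ^+ d * g ^+ 2 * (9 ^+ d.-1 * h ^+ 2) = (9 ^+ d * h) * (g ^+ 2 * 9 ^+ d.-1 * h) by ring.
  by rewrite dh le_eqVlt; apply/orP; left; apply/eqP; ring.
have hh : 9 ^+ d.-1 * h ^+ 2 <= 9 ^+ d * h ^+ 2.
  by rewrite ler_wpM2r ?sqr_ge0 // ler_weXn2l ?leq_pred // ler1n.
have e2 : 9 ^+ d * (g + h) ^+ 2 = 9 ^+ d * g ^+ 2 + 2 * (9 * 9 ^+ d.-1 * h) * g + 9 ^+ d * h ^+ 2.
  by rewrite -dh; ring.
by rewrite e2; lra.
Qed.

End Signs.

(** By [bonami] the fourth moment is at most [9 ^+ d] times the squared second moment; a pointwise
    bound of [F ^+ 2] by [|F|] and [F ^+ 4] then recovers the second moment from the first. *)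
Lemma khintchine (R : rcfType) (V X : finType) (b : X -> R) (P : pred X) (A : X -> {set V}) d :
    {in P &, injective A} -> (forall x, P x -> (#|A x| <= d)%N) ->
  Num.sqrt (\sum_(x | P x) b x ^+ 2)
    <= 4 * 3 ^+ d * mean (fun e => `|\sum_(x | P x) b x * walsh R (A x) e|).
Proof.
move=> Ai Ad; pose F e := \sum_(x | P x) b x * walsh R (A x) e.
set q := \sum_(x | P x) _.
change (is_true (Num.sqrt q <= 4 * 3 ^+ d * mean (fun e => `|F e|))).
have [E2 E4] : mean (fun e => F e ^+ 2) = q /\ mean (fun e => F e ^+ 4) <= 9 ^+ d * q ^+ 2.
  exact: (bonami b (fun x (_ : P x) => subsetT (A x)) Ai Ad).
have q0 : 0 <= q by apply: sumr_ge0 => x _; apply: sqr_ge0.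
have EF0 : 0 <= mean (fun e => `|F e|) by apply: mean_ge0.
have [->|sn0] := eqVneq (Num.sqrt q) 0; first by apply: mulr_ge0 EF0; rewrite mulr_ge0 ?exprn_ge0.
have s0 : 0 < Num.sqrt q by rewrite lt_neqAle eq_sym sn0 sqrtr_ge0.
have k0 : 0 < 3 ^+ d :> R by rewrite exprn_gt0.
have qE : q = Num.sqrt q ^+ 2 by rewrite sqr_sqrtr.
(* This scale makes the quartic term at most [q / 4], so that it can be absorbed. *)
pose c := 2 * 3 ^+ d * Num.sqrt q.
have c0 : 0 < c by rewrite !mulr_gt0.
(* the elementary [u^2 <= u + u^4] at [u = |F| / c] *)
have pt e : F e ^+ 2 <= c * `|F e| + c ^- 2 * F e ^+ 4.
  have -> : F e ^+ 4 = `|F e| ^+ 4 by rewrite -normrX ger0_norm ?exprn_even_ge0.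
  rewrite -(real_normK (num_real (F e))); move: `|F e| (normr_ge0 (F e)) => u u0.
  have [t ut t0] : exists2 t, u = c * t & 0 <= t.
    by exists (u / c); rewrite ?divr_ge0 ?(ltW c0) // mulrC divfK ?gt_eqF.
  rewrite ut; have -> : c ^- 2 * (c * t) ^+ 4 = c ^+ 2 * t ^+ 4 by field; rewrite gt_eqF.
  have -> : c * (c * t) = c ^+ 2 * t by ring.
  rewrite exprMn -mulrDr ler_wpM2l ?sqr_ge0 //.
  have [t1|t1] := leP t 1; first by nra.
  by rewrite ler_wpDl // ler_eXn2l.
have := ler_mean pt; rewrite E2 meanD !meanZ => le1.
have : c ^- 2 * mean (fun e => F e ^+ 4) <= q / 4.
  have -> : q / 4 = c ^- 2 * (9 ^+ d * q ^+ 2).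
    have -> : 9 ^+ d = (3 ^+ d) ^+ 2 :> R by rewrite -exprM mulnC exprM; congr (_ ^+ _); ring.
    by rewrite /c {1 3}qE; field; rewrite !gt_eqF.
  by rewrite ler_wpM2l // invr_ge0 sqr_ge0.
move=> le2; have : q * (3 / 4) <= c * mean (fun e => `|F e|) by lra.
rewrite {1}qE /c; set s := Num.sqrt q in s0 *.
have -> : s ^+ 2 * (3 / 4) = s * (s * (3 / 4)) by ring.
have -> : 2 * 3 ^+ d * s * mean (fun e => `|F e|) = s * (2 * 3 ^+ d * mean (fun e => `|F e|)) by ring.
rewrite ler_pM2l //.
have : 0 <= 3 ^+ d * mean (fun e => `|F e|) by rewrite mulr_ge0 // ltW.
by rewrite -!mulrA; move: (3 ^+ d * _) => z; lra.
Qed.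

(** * Polarization *)

Lemma sum_injective_ffun (R : nmodType) (m : nat) (F : {ffun 'I_m -> 'I_m} -> R) :
    (forall s : {ffun 'I_m -> 'I_m}, ~~ injectiveb s -> F s = 0) ->
  \sum_s F s = \sum_(s : 'S_m) F (pval s).
Proof.
move=> F0; rewrite (bigID (fun s : {ffun _} => injectiveb s)) /= [X in _ + X]big1 // addr0.
rewrite (reindex (fun s : 'S_m => pval s)); last first.
  by exists (insubd (1%g : 'S_m)) => [s|s si]; [rewrite valKd | rewrite insubdK].
by apply: eq_bigl => s; apply: (valP s).
Qed.

Section Polarization.
Variables (R : realFieldType) (m n : nat) (J : finType) (idx : J -> {ffun 'I_m -> 'I_n}).
Implicit Types (c : J -> R) (y : 'I_m -> 'I_n -> R).

Definition rpoly c (z : 'I_n -> R) : R := \sum_j c j * \prod_k z (idx j k).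

(** Coefficients of [m!] times the symmetric form of the polynomial. Omitting the division by [m!]
    lets them dominate the original coefficients over monotone indices. *)
Definition polar_coef c (x : {ffun 'I_m -> 'I_n}) : R :=
  \sum_j \sum_(s : 'S_m | [ffun k => x (s k)] == idx j) c j.

Definition polar_form c y : R := \sum_x polar_coef c x * \prod_l y l (x l).

(* Averaging over the signs keeps exactly the terms in which each of the [m]
   arguments occurs an odd number of times, hence once. *)
Lemma polarization c y :
  mean (fun e : {ffun 'I_m -> bool} =>
    walsh R setT e * rpoly c (fun i => \sum_l (-1) ^+ e l * y l i)) = polar_form c y.
Proof.
transitivity (\sum_j c j * \sum_(s : 'S_m) \prod_k y (s k) (idx j k)).
  rewrite (eq_mean (g := fun e : {ffun 'I_m -> bool} => \sum_j \sum_(s : {ffun 'I_m -> 'I_m})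
     (c j * \prod_k y (s k) (idx j k)) * (walsh R setT e * \prod_k (-1) ^+ e (s k)))); last first.
    move=> e; rewrite mulr_sumr; apply: eq_bigr => j _.
    rewrite mulrCA bigA_distr_bigA /= !mulr_sumr; apply: eq_bigr => s _.
    by rewrite big_split /=; ring.
  rewrite mean_sum; apply: eq_bigr => j _.
  rewrite mean_sum mulr_sumr sum_injective_ffun => [|s sN].
    apply: eq_bigr => s _; rewrite meanZ pvalE (eq_mean (g := fun=> 1)) ?mean_cst ?mulr1 // => e.
    rewrite /walsh (reindex_inj (@perm_inj _ s)) /= (eq_bigl xpredT) => [|k]; last by rewrite inE.
    by rewrite -big_split big1 //= => k _; rewrite -expr2 sqrr_sign.
  (* A non-injective [s] misses some [l]: flipping [e l] changes the sign of the full Walsh function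
     but not the product over [s], so the mean vanishes. *)
  have [l lN] : exists l, l \notin codom s.
    apply/existsP; rewrite -negb_forall; apply: contra sN => /forallP sS.
    have /image_injP sI : #|image s predT| == #|'I_m| by rewrite (eq_card (B := 'I_m)).
    by apply/injectiveP => a b; apply: sI.
  rewrite meanZ (mean_odd (v := l)) ?mulr0 // => e.
  rewrite (walshD1 _ (flip l e) (in_setT l)) (walshD1 _ e (in_setT l)).
  rewrite walsh_flip ?inE ?eqxx // ffunE eqxx addbT signrN !mulNr; congr (- (_ * _)).
  apply: eq_bigr => k _; rewrite ffunE; case: eqP => [skl|_]; last by rewrite addbF.
  by case/negP: lN; rewrite -skl codom_f.
rewrite /polar_form; under [RHS]eq_bigr do rewrite mulr_suml.
rewrite exchange_big /=; apply: eq_bigr => j _.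
under [RHS]eq_bigr do rewrite mulr_suml.
rewrite (exchange_big_dep xpredT) //= mulr_sumr; apply: eq_bigr => s _.
rewrite (big_pred1 [ffun l => idx j ((s^-1)%g l)]) => [|x].
  congr (_ * _); rewrite [RHS](reindex_inj (@perm_inj _ s)) /=.
  by apply: eq_bigr => k _; rewrite ffunE permK.
apply/eqP/eqP => [<-|->]; apply/ffunP => k; rewrite !ffunE ?permKV ?permK //.
Qed.

Lemma rpoly_scale c z a : rpoly c (fun i => a * z i) = a ^+ m * rpoly c z.
Proof.
rewrite /rpoly mulr_sumr; apply: eq_bigr => j _.
by rewrite big_split /= prodr_const card_ord mulrCA.
Qed.

(** Each signed sum of the [m] arguments has modulus at most [m]; rescaling it into the unit cube
    costs [m%:R ^+ m] by homogeneity. *)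
Lemma polar_form_bound c y (M : R) : (0 < m)%N ->
    (forall z, (forall i, `|z i| <= 1) -> `|rpoly c z| <= M) ->
    (forall l i, `|y l i| <= 1) ->
  `|polar_form c y| <= m%:R ^+ m * M.
Proof.
move=> m0 cM y1; have M0 : 0 < m%:R :> R by rewrite ltr0n.
rewrite -polarization -(mean_cst 'I_m (m%:R ^+ m * M)).
apply: (@le_trans _ _ (mean (fun e : {ffun 'I_m -> bool} =>
    `|walsh R setT e * rpoly c (fun i => \sum_l (-1) ^+ e l * y l i)|))).
  by rewrite /mean normrM normfV normr_nat ler_wpM2r ?invr_ge0 // ler_norm_sum.
apply: ler_mean => e; rewrite normrM.
have -> : `|walsh R setT e| = 1.
  by rewrite /walsh normr_prod big1 // => l _; rewrite normrX normrN1 expr1n.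
rewrite mul1r; set z := (fun i => _).
rewrite (_ : rpoly c z = rpoly c (fun i => m%:R * (z i / m%:R))); last first.
  apply: eq_bigr => j _; congr (_ * _); apply: eq_bigr => k _.
  by rewrite mulrC divfK // gt_eqF.
rewrite rpoly_scale normrM normrX normr_nat ler_wpM2l ?exprn_ge0 //.
apply: cM => i; rewrite normrM normfV normr_nat ler_pdivrMr // mul1r.
apply: le_trans (ler_norm_sum _ _ _) _.
rewrite -[m in m%:R]card_ord -sumr_const; apply: ler_sum => l _.
by rewrite normrM normrX normrN1 expr1n mul1r.
Qed.

End Polarization.

(** Khintchine bounds each inner norm by a mean of [|F i e|]. For fixed [e] the sum of these over
    [i] is a single value of the polarized form: the signs [e] in every argument but the [k]-th, and
    the sign of [F i e] in the [k]-th. *)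
Lemma mixed_norm_bound (R : rcfType) (m n : nat) (J : finType)
    (idx : J -> {ffun 'I_m -> 'I_n}) (c : J -> R) (M : R) (k : 'I_m) :
    (forall z, (forall i, `|z i| <= 1) -> `|rpoly idx c z| <= M) ->
  \sum_i Num.sqrt (\sum_(x : {ffun 'I_m -> 'I_n} | x k == i) polar_coef idx c x ^+ 2)
    <= 4 * 3 ^+ m * (m%:R ^+ m * M).
Proof.
move=> cM; have m0 : (0 < m)%N by apply: leq_ltn_trans (ltn_ord k).
pose b := polar_coef idx c.
(* The Walsh set of [x] is its graph off coordinate [k]; on a fibre [x k = i] it determines [x]. *)
pose A (x : {ffun 'I_m -> 'I_n}) : {set 'I_m * 'I_n} := [set (l, x l) | l in [set~ k]].
have memA x l i : ((l, i) \in A x) = (l != k) && (x l == i).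
  apply/imsetP/andP => [[l' + [-> ->]]|[lk /eqP <-]]; first by rewrite !inE eqxx.
  by exists l; rewrite ?inE.
pose F i e := \sum_(x : {ffun 'I_m -> 'I_n} | x k == i) b x * walsh R (A x) e.
apply: (@le_trans _ _ (\sum_i 4 * 3 ^+ m * mean (fun e => `|F i e|))).
  apply: ler_sum => i _; apply: khintchine => [x y /eqP xk /eqP yk Axy|x _].
    apply/ffunP => l; have [->|lk] := eqVneq l k; first by rewrite xk yk.
    by have := memA y l (x l); rewrite -Axy memA lk eqxx /= => /esym/eqP.
  by apply: leq_trans (leq_imset_card _ _) _; rewrite -[m in leqRHS]card_ord max_card.
rewrite -mulr_sumr ler_wpM2l ?mulr_ge0 ?exprn_ge0 // -mean_sum.
rewrite -[leRHS](mean_cst ('I_m * 'I_n)%type); apply: ler_mean => e.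
pose y l i := if l == k then Num.sg (F i e) else (-1) ^+ e (l, i).
suff -> : \sum_i `|F i e| = polar_form idx c y.
  apply: le_trans (ler_norm _) _; apply: polar_form_bound => // l i.
  rewrite /y; case: eqP => _; first by rewrite normr_sg lern1 leq_b1.
  by rewrite normrX normrN1 expr1n.
rewrite /polar_form (partition_big (fun x : {ffun _} => x k) xpredT) //=.
apply: eq_bigr => i _; rewrite normrEsg mulr_sumr; apply: eq_bigr => x /eqP xk.
rewrite mulrCA (bigD1 k) //= {1}/y eqxx xk; congr (_ * (_ * _)).
rewrite /walsh /A big_imset /=; last by move=> l l' _ _ [].
rewrite (eq_bigl (fun l => l != k)) => [|l]; last by rewrite !inE.
by apply: eq_bigr => l lk; rewrite /y (negbTE lk).
Qed.

(** * Coefficients over monotone index tuples *)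

Definition Jfun (m n : nat) (j : Jidx m n) : {ffun 'I_m -> 'I_n} := [ffun k => tnth (val j) k].

(** A list has only one sorted rearrangement, so distinct monotone tuples lie in distinct
    permutation orbits. *)
Lemma Jfun_perm m n (j j' : Jidx m n) (s : 'S_m) :
  [ffun k => Jfun j (s k)] = Jfun j' -> j = j'.
Proof.
move=> e; apply/val_inj/val_inj; apply/esym.
apply: (@sorted_eq _ (fun i j : 'I_n => (i <= j)%N)).
- by move=> a b d; apply: leq_trans.
- by move=> a b /anti_leq /val_inj.
- exact: (valP j').
- exact: (valP j).
apply/tuple_permP; exists s; congr (tval _); apply: eq_from_tnth => k.
by rewrite tnth_mktuple; move/ffunP: e => /(_ k); rewrite !ffunE.
Qed.

Lemma Jfun_inj m n : injective (@Jfun m n).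
Proof.
move=> j j' e; apply: (@Jfun_perm _ _ _ _ 1%g); rewrite -e.
by apply/ffunP => k; rewrite !ffunE perm1.
Qed.

(** By [Jfun_perm] only [c j] itself contributes, once for each permutation fixing the tuple, the
    identity among them. *)
Lemma polar_coef_Jfun (R : realFieldType) m n (c : Jidx m n -> R) (j : Jidx m n) :
  `|c j| <= `|polar_coef (@Jfun m n) c (Jfun j)|.
Proof.
rewrite /polar_coef (bigD1 j) //= [X in _ + X]big1 ?addr0 => [|j' jj'].
  rewrite sumr_const normrMn -mulr_natr ler_peMr ?ler1n //.
  apply/card_gt0P; exists 1%g.
  suff : [ffun k => Jfun j ((1 : 'S_m)%g k)] == Jfun j by [].
  by apply/eqP/ffunP => k; rewrite !ffunE perm1.
rewrite big_pred0 // => s; apply/eqP => /Jfun_perm e.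
by rewrite e eqxx in jj'.
Qed.

(** * Fibre selection for ranked points of a grid *)

Lemma index_filter (T : eqType) (p : pred T) (x : T) (s : seq T) :
  p x -> index x (filter p s) = count p (take (index x s) s).
Proof.
move=> px; elim: s => //= a s IH; have [->|ax] := eqVneq a x; first by rewrite px /= eqxx.
by case: ifP => pa /=; rewrite ?(negbTE ax) IH pa.
Qed.

Lemma ler_sum_subpred (R : numDomainType) (T : eqType) (s : seq T) (P Q : pred T) (f : T -> R) :
    (forall x, 0 <= f x) -> (forall x, x \in s -> P x -> Q x) ->
  \sum_(x <- s | P x) f x <= \sum_(x <- s | Q x) f x.
Proof.
move=> f0 PQ; rewrite big_seq_cond [leRHS]big_seq_cond big_mkcond [leRHS]big_mkcond.
apply: ler_sum => x _; case: (boolP (x \in s)) => //= xs.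
by case: ifP => [/(PQ _ xs) ->//|_]; case: ifP.
Qed.

Section FibreSelection.
Variables (R : realFieldType) (m : nat) (I : finType) (r : nat -> R).
Hypotheses (r_ge0 : forall t, 0 <= r t) (rX : forall t, r t ^+ m.+1 = t%:R).

(** Since [r t] is the root of order [m.+1] of [t], this is [(t+1)^(1/(m+1) - 1)], with ranks
    counted from 0. *)
Definition rank_weight (t : nat) : R := r t.+1 ^- m.
Local Notation wt := rank_weight.
Local Notation grid := {ffun 'I_m.+1 -> I}.

Lemma root_homo : {homo r : s t / (s <= t)%N >-> s <= t}.
Proof.
by move=> s t st; rewrite -(@ler_pXn2r _ m.+1) ?nnegrE // !rX ler_nat.
Qed.

Lemma root_gt0 t : 0 < r t.+1.
Proof.
rewrite lt_neqAle r_ge0 andbT eq_sym; apply/eqP => e.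
by have /eqP := rX t.+1; rewrite e expr0n /= eq_sym pnatr_eq0.
Qed.

Lemma rank_weight_ge0 t : 0 <= wt t.
Proof. by rewrite invr_ge0 exprn_ge0. Qed.

(** Telescoping: factoring [1 = r t.+1 ^+ m.+1 - r t ^+ m.+1] bounds [wt t] by [m.+1] times the
    increment of [r]. *)
Lemma sum_rank_weight t : \sum_(s < t) wt s <= m.+1%:R * r t.
Proof.
elim: t => [|t IHt]; first by rewrite big_ord0 mulr_ge0.
rewrite big_ord_recr /=; apply: le_trans (lerD IHt (lexx _)) _.
rewrite -lerBrDl -mulrBr.
have up : 0 < r t.+1 ^+ m by rewrite exprn_gt0 ?root_gt0.
rewrite /rank_weight -(ler_pM2r up) mulVf ?gt_eqF //.
rewrite [leLHS](_ : 1 = r t.+1 ^+ m.+1 - r t ^+ m.+1); last first.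
  by rewrite !rX -natrB // subSnn.
rewrite subrXX -mulrA [m.+1%:R * _]mulrC -mulrA ler_wpM2l ?subr_ge0 ?root_homo //.
rewrite mulr_natr -[m.+1 in leRHS]card_ord -sumr_const; apply: ler_sum => i _.
have -> : r t.+1 ^+ m = r t.+1 ^+ (m - i) * r t.+1 ^+ i.
  by rewrite -exprD subnK // -ltnS.
by rewrite ler_wpM2l ?exprn_ge0 // lerXn2r ?nnegrE // root_homo.
Qed.

(** A rank larger by the factor [2 ^ m.+1] has a root at least twice as large. *)
Lemma rank_weight_scale q t : (2 ^ m.+1 * q.+1 <= t.+1)%N -> wt t <= wt q / 2 ^+ m.
Proof.
move=> qt; rewrite /rank_weight -invfM.
rewrite lef_pV2 ?posrE ?mulr_gt0 ?exprn_gt0 ?root_gt0 // -exprMn.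
rewrite lerXn2r ?nnegrE ?mulr_ge0 // -(@ler_pXn2r _ m.+1) ?nnegrE ?mulr_ge0 //.
by rewrite exprMn !rX -natrX -natrM ler_nat mulnC.
Qed.

Definition load (g : seq grid) k i t : R :=
  \sum_(x <- g | (x k == i) && (index x g < t)%N) wt (index x g).
(** The cutoff is twice the constant in [sum_rank_weight]. The successor makes [x] count towards its
    own fibre. *)
Definition light g (x : grid) k := load g k (x k) (index x g).+1 <= (2 * m.+1)%:R.
Definition heavy g x := [forall k, ~~ light g x k].

(** The fibres in a fixed direction partition the ranked points, so their total load does not depend
    on the direction. *)
Lemma sum_load g k t : uniq g -> (t <= size g)%N ->
  \sum_i load g k i t = \sum_(s < t) wt s.
Proof.
move=> ug tg; transitivity (\sum_(x <- g | (index x g < t)%N) wt (index x g)).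
  rewrite (exchange_big_dep xpredT) //= [RHS]big_mkcond /=; apply: eq_bigr => x _.
  case: ifP => xt; last by rewrite big_pred0 // => i; rewrite andbF.
  by rewrite (big_pred1 (x k)) // => i; rewrite andbT eq_sym.
case: g ug tg => [|x0 g] ug tg.
  by move: tg; rewrite leqn0 => /eqP ->; rewrite big_nil big_ord0.
move: (x0 :: g) ug tg => {}g ug tg.
rewrite (big_nth x0) -(big_mkord xpredT wt) [RHS](big_nat_widen _ _ (size g)) //=.
rewrite big_nat_cond [RHS]big_nat_cond.
apply: congr_big => // [s|s /andP[/andP[_ sg] _]]; last by rewrite index_uniq.
by case: (boolP (0 <= s < _)%N) => //= /index_uniq ->.
Qed.

(* At most [r t / 2] fibres in each direction are overloaded, and a heavy
   point lies in an overloaded fibre in every direction. *)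
Lemma count_heavy g t : uniq g -> (t <= size g)%N ->
  (2 ^ m.+1 * count (heavy g) (take t g) <= t)%N.
Proof.
move=> ug tg; pose A k := [pred i | (2 * m.+1)%:R < load g k i t].
(* The overloaded fibres span a box containing every heavy point ranked below [t]. *)
have le1 : (count (heavy g) (take t g) <= #|family A|)%N.
  rewrite -size_filter -(card_uniqP _); last by rewrite filter_uniq ?take_uniq.
  apply/subset_leq_card/subsetP => x; rewrite mem_filter => /andP[/forallP hx xt].
  apply/familyP => k; rewrite inE /=; have := hx k; rewrite /light -ltNge => lt.
  apply: (lt_le_trans lt); apply: ler_sum_subpred => [y|y yg /andP[-> yx]].
    exact: rank_weight_ge0.
  by rewrite (leq_trans yx) // -in_take ?(mem_take xt).
apply: leq_trans (leq_mul (leqnn _) le1) _.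
(* As [r t ^+ m.+1 = t], the claim factors over directions into [2 * #|A k| <= r t]. *)
rewrite card_family -(ler_nat R) natrM natrX -[in leRHS]rX.
have -> : foldr muln 1%N [seq #|A x| | x : 'I_m.+1] = (\prod_k #|A k|)%N.
  by rewrite foldrE big_image.
rewrite natr_prod -[X in 2 ^+ X]card_ord -[X in r t ^+ X]card_ord.
rewrite -!prodr_const -big_split /=; apply: ler_prod => k _.
rewrite mulr_ge0 //=.
have M0 : 0 < m.+1%:R :> R by rewrite ltr0n.
rewrite -(ler_pM2l M0); apply: le_trans (sum_rank_weight t).
rewrite -(sum_load k ug tg) (bigID (A k)) /=.
apply: ler_wpDr; first by apply: sumr_ge0 => i _; apply: sumr_ge0 => x _; apply: rank_weight_ge0.
rewrite mulrA -natrM mulnC mulr_natr -sumr_const; apply: ler_sum => i Ai.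
exact: ltW.
Qed.

(** The last-ranked point among those summed is light, and all the others precede it in the same
    fibre, so the load at that point bounds the sum. *)
Lemma sum_light g (kap : grid -> 'I_m.+1) k i :
  \sum_(x <- g | [&& kap x == k, x k == i & light g x (kap x)]) wt (index x g) <= (2 * m.+1)%:R.
Proof.
pose Q x := [&& kap x == k, x k == i & light g x (kap x)].
case: (pickP (fun x => (x \in g) && Q x)) => [x0 Qx0|Q0]; last first.
  rewrite big_seq_cond big_pred0 ?ler0n // => x; exact: Q0.
case: (@arg_maxnP _ x0 (fun x => (x \in g) && Q x) (fun x => index x g) Qx0) => x /andP[xg /and3P[/eqP kx /eqP xi]].
rewrite /light kx xi => xl xmax; apply: le_trans xl.
apply: ler_sum_subpred => [y|y yg /and3P[ky yi yl]]; first exact: rank_weight_ge0.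
by rewrite yi ltnS; apply: xmax; rewrite yg /Q ky yi; exact: yl.
Qed.

(* Points that are heavy are rare, so re-ranking them among themselves at least
   halves their weights and the remaining load is a geometric series. *)
Lemma fibre_selection g : (0 < m)%N -> uniq g ->
  exists kap : grid -> 'I_m.+1, forall k i,
    \sum_(x <- g | (kap x == k) && (x k == i)) wt (index x g) <= 4 * m.+1%:R.
Proof.
move=> m0; move: {2}(size g) (leqnn (size g)) => N; elim: N g => [|N IHN] g gN ug.
  exists (fun=> ord0) => k i; move: gN; rewrite leqn0 size_eq0 => /eqP ->.
  by rewrite big_nil mulr_ge0.
have heavyN : (size (filter (heavy g) g) <= N)%N.
  rewrite size_filter; have := count_heavy ug (leqnn _); rewrite take_size.
  have : (1 < 2 ^ m.+1)%N by rewrite -{1}(expn0 2) ltn_exp2l.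
  by move: (2 ^ m.+1)%N (count _ _) => a c; nia.
have [kap' kapP] := IHN _ heavyN (filter_uniq _ ug).
pose kap x := if [pick k | light g x k] is Some k then k else kap' x.
have kapL x : light g x (kap x) = ~~ heavy g x.
  rewrite /kap /heavy negb_forall; case: pickP => [k lk|nl].
    by rewrite lk; symmetry; apply/existsP; exists k; rewrite negbK.
  by rewrite nl; symmetry; apply/existsP => -[k]; rewrite negbK nl.
have kapH x : heavy g x -> kap x = kap' x.
  by rewrite /kap => /forallP h; case: pickP => // k lk; move: (h k); rewrite lk.
exists kap => k i; rewrite (bigID (fun x => light g x (kap x))) /=.
(* The light points use half of the bound; the heavy ones get the inductive bound halved. *)
have -> : 4 * m.+1%:R = (2 * m.+1)%:R + 4 * m.+1%:R / 2 :> R by rewrite natrM; field.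
apply: lerD.
  by under eq_bigl do rewrite -andbA; apply: sum_light.
apply: (@le_trans _ _ (\sum_(x <- filter (heavy g) g | (kap' x == k) && (x k == i))
   wt (index x (filter (heavy g) g)) / 2)); last first.
  by rewrite -mulr_suml ler_wpM2r ?invr_ge0 ?kapP.
rewrite big_filter_cond big_seq_cond [leRHS]big_seq_cond.
rewrite [leRHS](eq_bigl (fun x => (x \in g) && ((kap x == k) && (x k == i) && ~~ light g x (kap x)))); last first.
  move=> x; rewrite kapL negbK; case: (boolP (heavy g x)) => /= h; last by rewrite !andbF.
  by rewrite kapH // andbT.
apply: ler_sum => x /andP[xg /andP[_]]; rewrite kapL negbK => hx.
have xs : (index x g < size g)%N by rewrite index_mem.
apply: (@le_trans _ _ (wt (index x (filter (heavy g) g)) / 2 ^+ m)).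
  apply: rank_weight_scale; rewrite index_filter //.
  (* The prefix used ends at [x], which is itself heavy; this supplies the extra 1 in its new
     rank. *)
  have := count_heavy ug xs.
  by rewrite (take_nth x) // nth_index // -cats1 count_cat /= hx addn0 addn1.
(* Positivity of [m] makes [2 ^+ m] at least 2. *)
rewrite ler_wpM2l ?rank_weight_ge0 // lef_pV2 ?posrE ?exprn_gt0 //.
by case: (m) m0 => // m' _; rewrite exprS ler_peMr // exprn_ege1 // ler1n.
Qed.

End FibreSelection.

(** * The Lorentz norm *)

Lemma fibre_selection_exists (R : realFieldType) (m : nat) (I : finType) (r : nat -> R)
    (g : seq {ffun 'I_m.+1 -> I}) :
    (forall t, 0 <= r t) -> (forall t, r t ^+ m.+1 = t%:R) -> uniq g ->
  exists kap : {ffun 'I_m.+1 -> I} -> 'I_m.+1, forall k i,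
    \sum_(x <- g | (kap x == k) && (x k == i)) rank_weight m r (index x g) <= 4 * m.+1%:R.
Proof.
move=> r0 rX ug; case: (posnP m) => [m0|mp]; last exact: fibre_selection.
(* In dimension one every fibre is a single point and every weight is 1. *)
subst m; exists (fun=> ord0) => k i.
apply: (@le_trans _ _ (\sum_(x <- g | x == [ffun=> i]) 1)).
  rewrite (eq_bigr (fun=> 1)) => [|x _]; last by rewrite /rank_weight expr0 invr1.
  apply: ler_sum_subpred => // x _ /andP[_ /eqP xk].
  by apply/eqP/ffunP => l; rewrite ffunE -xk !ord1.
by rewrite big_const_seq iter_addr_0 (count_uniq_mem _ ug) mulr1 ler_nat; case: (_ \in _).
Qed.

Section RealCase.
Variables (R : realType) (m : nat).

Definition nat_root (t : nat) : R := t%:R `^ m.+1%:R^-1.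

Lemma nat_root_ge0 t : 0 <= nat_root t.
Proof. exact: powR_ge0. Qed.

Lemma nat_rootX t : nat_root t ^+ m.+1 = t%:R.
Proof. by rewrite -powR_mulrn ?powR_ge0 // -powRrM mulVf ?pnatr_eq0 // powRr1. Qed.

(** Equals [(t+1)^(1/p - 1)] for [p = 2(m+1)/(m+2)], the Lorentz exponent in degree [m.+1]; the
    square root is the form that Cauchy-Schwarz uses. *)
Definition lorentz_weight (t : nat) : R := Num.sqrt (rank_weight m nat_root t).

Lemma lorentz_weightE t :
  lorentz_weight t = (t.+1%:R `^ (m%:R / (2 * m.+1%:R)))^-1.
Proof.
rewrite /lorentz_weight /rank_weight sqrtrV ?exprn_ge0 ?powR_ge0 //; congr (_^-1).
rewrite -powR12_sqrt ?exprn_ge0 ?powR_ge0 // -powR_mulrn ?powR_ge0 //.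
rewrite /nat_root -!powRrM; congr (_ `^ _).
by field; rewrite nat1r pnatr_eq0.
Qed.

(** Multiplied by [(t+1)^b] this reads [(t+1) - t^a (t+1)^b <= 1], and
    [t^a (t+1)^b >= t^a t^b = t]. *)
Lemma powR_increment (a b : R) (t : nat) : a + b = 1 -> 0 <= b ->
  t.+1%:R `^ a - t%:R `^ a <= (t.+1%:R `^ b)^-1.
Proof.
move=> ab b0; have u0 : 0 < t.+1%:R `^ b :> R by rewrite powR_gt0 // ltr0n.
rewrite -(ler_pM2r u0) mulVf ?gt_eqF // mulrBl -powRD ?ab ?oner_eq0 // powRr1 //.
rewrite -natr1 lerBlDr addrC lerD2l nat1r.
have [->|tn0] := eqVneq t 0%N; first by rewrite mulr_ge0 ?powR_ge0.
rewrite -[leLHS]powRr1 // -ab powRD ?ab ?oner_eq0 // ler_wpM2l ?powR_ge0 //.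
by apply: ge0_ler_powR; rewrite ?nnegrE // ler_nat.
Qed.

(** One factor for the number of directions, one for the fibre loads, the last from
    [mixed_norm_bound]. *)
Definition bh_constant : R :=
  m.+1%:R * (Num.sqrt (4 * m.+1%:R) * (4 * 3 ^+ m.+1 * m.+1%:R ^+ m.+1)).

(** The sum splits by selected direction, then by fibre. On each fibre Cauchy-Schwarz separates the
    coefficients, controlled by [mixed_norm_bound], from the squared weights, controlled by
    [fibre_selection_exists]. *)
Lemma real_lorentz_bound n (c : Jidx m.+1 n -> R) (M : R) (s : seq (Jidx m.+1 n)) :
    uniq s -> (forall z, (forall i, `|z i| <= 1) -> `|rpoly (@Jfun _ _) c z| <= M) ->
  \sum_(j <- s) `|c j| * lorentz_weight (index j s) <= bh_constant * M.
Proof.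
move=> us cM; pose b := polar_coef (@Jfun m.+1 n) c; pose g := map (@Jfun m.+1 n) s.
have ug : uniq g by rewrite map_inj_uniq //; apply: Jfun_inj.
have [kap kapP] := fibre_selection_exists nat_root_ge0 nat_rootX ug.
apply: (@le_trans _ _ (\sum_(x <- g) `|b x| * lorentz_weight (index x g))).
  rewrite big_map; apply: ler_sum => j _; rewrite index_map; last exact: Jfun_inj.
  by rewrite ler_wpM2r ?sqrtr_ge0 // polar_coef_Jfun.
have -> : bh_constant * M = m.+1%:R * (Num.sqrt (4 * m.+1%:R) *
    (4 * 3 ^+ m.+1 * (m.+1%:R ^+ m.+1 * M))) by rewrite /bh_constant !mulrA.
rewrite (partition_big kap xpredT) //= [leRHS]mulr_natl -[X in _ *+ X]card_ord -sumr_const; apply: ler_sum => k _.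
rewrite (partition_big (fun x : {ffun _} => x k) xpredT) //=.
apply: (@le_trans _ _ (\sum_i Num.sqrt (4 * m.+1%:R) *
    Num.sqrt (\sum_(x : {ffun 'I_m.+1 -> 'I_n} | x k == i) b x ^+ 2))); last first.
  rewrite -mulr_sumr ler_wpM2l ?sqrtr_ge0 //.
  exact: mixed_norm_bound.
apply: ler_sum => i _; rewrite -sqrtrM ?mulr_ge0 //.
apply: (le_trans (ler_norm _)); rewrite -sqrtr_sqr ler_wsqrtr //.
apply: (le_trans (cauchy_schwarz _ _ _ _)); rewrite [leRHS]mulrC; apply: ler_pM.
- by apply: sumr_ge0 => x _; apply: sqr_ge0.
- by apply: sumr_ge0 => x _; apply: sqr_ge0.
- rewrite -big_filter big_uniq ?filter_uniq //=.
  rewrite (eq_bigr (fun x => b x ^+ 2)) => [|x _]; last by rewrite real_normK ?num_real.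
  apply: ler_sum_subpred => [x|x _]; first exact: sqr_ge0.
  by rewrite mem_filter => /andP[/andP[]].
- rewrite (eq_bigr (fun x => rank_weight m nat_root (index x g))) ?kapP // => x _.
  by rewrite sqr_sqrtr // rank_weight_ge0 //; apply: nat_root_ge0.
Qed.

End RealCase.

(** * From complex to real coefficients *)

Section ComplexModulus.
Variable R : rcfType.
Implicit Types (x y : R[i]).

Lemma cabs_le_ReIm x : cabs x <= `|complex.Re x| + `|complex.Im x|.
Proof.
case: x => a b; rewrite /cabs /= -[leRHS]ger0_norm ?addr_ge0 // -(sqrtr_sqr (`|a| + `|b|)).
rewrite ler_wsqrtr // -(real_normK (num_real a)) -(real_normK (num_real b)).
by rewrite sqrrD lerD2r lerDl mulrn_wge0 // mulr_ge0.
Qed.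

Lemma Re_le_cabs x : `|complex.Re x| <= cabs x.
Proof. by case: x => a b; rewrite /cabs /= -sqrtr_sqr ler_wsqrtr // lerDl sqr_ge0. Qed.

Lemma Im_le_cabs x : `|complex.Im x| <= cabs x.
Proof. by case: x => a b; rewrite /cabs /= -sqrtr_sqr ler_wsqrtr // lerDr sqr_ge0. Qed.

Lemma cabs_real (a : R) : cabs (real_complex R a) = `|a|.
Proof. by rewrite /cabs /= expr0n addr0 sqrtr_sqr. Qed.

Lemma cabs_ge0 x : 0 <= cabs x.
Proof. by case: x => a b; apply: sqrtr_ge0. Qed.

Lemma Re_polyJ m n (c : Jidx m n -> R[i]) (z : 'I_n -> R) :
  complex.Re (polyJ c (fun i => real_complex R (z i)))
    = rpoly (@Jfun m n) (fun j => complex.Re (c j)) z.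
Proof.
rewrite /polyJ (big_morph (@complex.Re R) (id1 := 0) (op1 := +%R)) //; last by case=> ? ? [].
apply: eq_bigr => j _; rewrite -rmorph_prod /=.
rewrite (eq_bigr (fun k => z (Jfun j k))) => [|k _]; last by rewrite ffunE.
by case: (c j) => a b /=; rewrite mulr0 subr0.
Qed.

Lemma Im_polyJ m n (c : Jidx m n -> R[i]) (z : 'I_n -> R) :
  complex.Im (polyJ c (fun i => real_complex R (z i)))
    = rpoly (@Jfun m n) (fun j => complex.Im (c j)) z.
Proof.
rewrite /polyJ (big_morph (@complex.Im R) (id1 := 0) (op1 := +%R)) //; last by case=> ? ? [].
apply: eq_bigr => j _; rewrite -rmorph_prod /=.
rewrite (eq_bigr (fun k => z (Jfun j k))) => [|k _]; last by rewrite ffunE.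
by case: (c j) => a b /=; rewrite mulr0 add0r.
Qed.

(** A crude bound showing that the supremum norm is taken over a bounded set. *)
Lemma cabs_polyJ_le m n (c : Jidx m n -> R[i]) (z : 'I_n -> R[i]) :
  (forall i, cabs (z i) <= 1) -> cabs (polyJ c z) <= \sum_j cabs (c j).
Proof.
move=> z1; rewrite /polyJ; elim/big_ind2: _ => [|x a y b xa yb|j _].
- by rewrite /cabs ComplexField.Normc.normc0.
- by apply: le_trans (le_normcD _ _) _; apply: lerD.
rewrite /cabs ComplexField.Normc.normcM -/(cabs _) ler_piMr ?cabs_ge0 //.
rewrite -/(cabs _) (big_morph (@cabs R) (id1 := 1) (op1 := *%R)); first last.
- exact: ComplexField.Normc.normc1.
- exact: ComplexField.Normc.normcM.
by apply: prodr_ile1 => k _; rewrite cabs_ge0 z1.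
Qed.

End ComplexModulus.

Lemma supnorm_poly_ub (R : realType) m n (c : Jidx m n -> R[i]) (z : 'I_n -> R) :
  (forall i, `|z i| <= 1) -> cabs (polyJ c (fun i => real_complex R (z i))) <= supnorm_poly c.
Proof.
move=> z1; apply: ub_le_sup.
  by exists (\sum_j cabs (c j)) => _ [w w1 <-]; apply: cabs_polyJ_le.
by exists (fun i => real_complex R (z i)) => // i; rewrite cabs_real.
Qed.

(** Sorting the indices by decreasing modulus, instead of the values, realizes the rearrangement as
    a ranking of the index set. *)
Lemma lorentz_norm_le (R : realType) (p : R) (I : finType) (x : I -> R) (w : nat -> R) :
    (forall t, t.+1%:R `^ p^-1 - t%:R `^ p^-1 <= w t) ->
  exists2 s : seq I, uniq s & lorentz_norm p x <= \sum_(i <- s) `|x i| * w (index i s).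
Proof.
move=> pw; pose s := sort (relpre (fun i => `|x i|) (fun a b : R => b <= a)) (enum I).
have us : uniq s by rewrite sort_uniq enum_uniq.
exists s => //; rewrite /lorentz_norm sort_map -/s.
case: s us => [|i0 s'] us; first by rewrite big_ord0 big_nil.
move: (i0 :: s') us => s us.
rewrite (big_nth i0) size_map big_mkord; apply: ler_sum => k _.
by rewrite (nth_map i0) // index_uniq // ler_wpM2l.
Qed.

Theorem theorem5p1 (R : realType) (m : nat) (hm : (1 <= m)%N) :
  exists C : R, 0 < C /\
    forall (n : nat) (c : Jidx m n -> R[i]),
      lorentz_norm ((2 * m)%:R / (m.+1)%:R) (fun j => cabs (c j))
        <= C * supnorm_poly c.
Proof.
case: m hm => // m _.
have C0 : 0 < bh_constant R m.
  by rewrite !mulr_gt0 ?sqrtr_gt0 ?exprn_gt0 ?mulr_gt0 ?ltr0n.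
(* The factor 2 accounts for the real and imaginary parts. *)
exists (2 * bh_constant R m); split=> [|n c]; first by rewrite mulr_gt0.
have [|s us le_s] := lorentz_norm_le (p := (2 * m.+1)%:R / m.+2%:R)
  (fun j => cabs (c j)) (w := lorentz_weight R m).
  (* The exponents [1/p = (m+2)/(2(m+1))] and [m/(2(m+1))] add up to 1. *)
  move=> t; rewrite lorentz_weightE; apply: powR_increment.
    by rewrite natrM -!natr1; field; rewrite !natr1 !pnatr_eq0.
  by rewrite divr_ge0 // mulr_ge0.
apply: (le_trans le_s); rewrite mulr_natl mulrnAl mulr2n.
apply: (@le_trans _ _ (\sum_(j <- s) `|complex.Re (c j)| * lorentz_weight R m (index j s) +
   \sum_(j <- s) `|complex.Im (c j)| * lorentz_weight R m (index j s))).
  rewrite -big_split /=; apply: ler_sum => j _.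
  by rewrite -mulrDl ler_wpM2r ?sqrtr_ge0 // ger0_norm ?cabs_ge0 // cabs_le_ReIm.
by apply: lerD; apply: real_lorentz_bound => // z z1;
  rewrite -?Re_polyJ -?Im_polyJ; apply: le_trans (supnorm_poly_ub c z1);
  [apply: Re_le_cabs|apply: Im_le_cabs].
Qed.
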